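(* Let $\varphi:\mathbb{K}\to[0,\infty)$ be a function with $\varphi(\hat1)=1$. There exists a unique Radon measure $\mu$ on $\mathcal{F}$ that represents $\varphi$, i.e. satisfies $\varphi(x)=\mu(\{V\in\mathcal{F}: x\in V\})$ for all $x\in\mathbb{K}$, if and only if $\varphi$ is a completely monotone Scott function on $\mathbb{K}$.
   Context: A dcpo is a poset in which every (nonempty) directed subset has a supremum. In a dcpo, $x\ll y$ means that every directed $E$ with $y\le\sup E$ contains some $w$ with $x\le w$. A domain is a dcpo in which, for each $x$, the set $\{z: z\ll x\}$ is a directed lower set with supremum $x$. A subset $U$ is Scott open if it is an upper set and meets every directed $E$ with $\sup E\in U$. The Lawson topology has as subbase the Scott open sets together with the complements of the principal upper sets $\{z: x\le z\}$. $\mathbb{K}$ is a domain which is also a lattice with top element $\hat1$, such that $\hat1\ll\hat1$ and $\ll$ is multiplicative: $a\ll x$, $b\ll y$ imply $a\wedge b\ll x\wedge y$. $\mathcal{F}=\mathrm{OFilt}(\mathbb{K})$ is the set of Scott open filters (nonempty, down-directed Scott open sets) of $\mathbb{K}$ ordered by inclusion; it is a continuous lattice and is given its Lawson topology, which is compact Hausdorff (with subbase the sets $\{V\in\mathcal{F}:x\in V\}$, $x\in\mathbb{K}$, and $\{W\in\mathcal{F}: V\not\subseteq W\}$, $V\in\mathcal{F}$). A Radon measure is a Borel measure, finite on compact sets, inner regular on open sets and outer regular on Borel sets. A Scott function is a function $\varphi:\mathbb{K}\to[0,\infty)$ with $\varphi(x)=\sup_{z\ll x}\varphi(z)$ for all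 $x$ (in particular increasing), normalized by $\varphi(\hat1)=1$. For $z\in\mathbb{K}$ put $\nabla_z\varphi(x)=\varphi(x)-\varphi(x\wedge z)$ and $\nabla_{z_1,\ldots,z_n}\varphi=\nabla_{z_n}(\nabla_{z_1,\ldots,z_{n-1}}\varphi)$; this depends only on $A=\{z_1,\ldots,z_n\}$ and is denoted $\nabla_A\varphi$. An increasing $\varphi$ is completely monotone if $\nabla_A\varphi\ge0$ for every nonempty finite $A\subseteq\mathbb{K}$. *)

(* Defs.v *)
From HB Require Import structures.
From mathcomp Require Import all_boot all_order all_algebra.
From mathcomp Require Import all_classical all_reals all_analysis.

Set Implicit Arguments.
Unset Strict Implicit.
Unset Printing Implicit Defensive.

Import Order.TTheory GRing.Theory Num.Theory.

Local Open Scope classical_set_scope.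
Local Open Scope ring_scope.

Section Domains.
Context {d : Order.disp_t} {P : porderType d}.
Implicit Types (x y z s : P) (E U : set P).

Definition directed E : Prop :=
  E !=set0 /\
  forall x y, E x -> E y -> exists z, [/\ E z, (x <= z)%O & (y <= z)%O].

Definition upper_set U : Prop := forall x y, (x <= y)%O -> U x -> U y.

Definition lower_set U : Prop := forall x y, (x <= y)%O -> U y -> U x.

(* In a poset [supremums E] has at most one element, so [supremums E s] reads
   "sup E exists and is equal to s". *)
Definition way_below x y : Prop :=
  forall E s, directed E -> supremums E s -> (y <= s)%O ->
    exists2 w, E w & (x <= w)%O.

Definition scott_open U : Prop :=
  upper_set U /\
  forall E s, directed E -> supremums E s -> U s -> E `&` U !=set0.

Definition lawson_subbase : set (set P) :=
  [set U | scott_open U] `|` [set ~` [set z | (x <= z)%O] | x in [set: P]].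

End Domains.

Definition is_dcpo {d : Order.disp_t} (P : porderType d) : Prop :=
  forall E : set P, directed E -> supremums E !=set0.

Definition is_domain {d : Order.disp_t} (P : porderType d) : Prop :=
  is_dcpo P /\
  forall x : P, let D := [set z | way_below z x] in
    [/\ directed D, lower_set D & supremums D x].

Definition multiplicative_way_below {d : Order.disp_t} (K : latticeType d) :
  Prop :=
  forall a b x y : K, way_below a x -> way_below b y ->
    way_below (a `&` b)%O (x `&` y)%O.

Definition scott_open_filter {d : Order.disp_t} {P : porderType d} :
  set (set P) :=
  [set V | [/\ V !=set0,
               forall x y, V x -> V y ->
                 exists z, [/\ V z, (z <= x)%O & (z <= y)%O]
             & scott_open V]].

Section OpenFilters.
Context {d : Order.disp_t} (K : tLatticeType d).

Record OFilt := MkOFilt {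
  ofilt_set : set K;
  _ : ofilt_set \in scott_open_filter }.

HB.instance Definition _ := [isSub for ofilt_set].
HB.instance Definition _ := [Choice of OFilt by <:].
(* The order inherited from [set K] is inclusion. *)
HB.instance Definition _ :=
  [SubChoice_isSubPOrder of OFilt by <: with set_display].

Lemma ofilt_leE (V W : OFilt) :
  (V <= W)%O = `[< ofilt_set V `<=` ofilt_set W >].
Proof. by rewrite -subsetEset; apply/idP/asboolP; rewrite subsetEset. Qed.

Lemma scott_open_filterT : [set: K] \in scott_open_filter.
Proof.
rewrite inE; split; first by exists \top%O.
  by move=> x y _ _; exists (x `&` y)%O; split => //; [exact: leIl|exact: leIr].
by split=> // E s [[x Ex] _] _ _; exists x.
Qed.

HB.instance Definition _ := isPointed.Build OFilt (MkOFilt scott_open_filterT).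

HB.instance Definition _ :=
  @isSubBaseTopological.Build OFilt (set OFilt) lawson_subbase id.

End OpenFilters.

Definition borel (T : ptopologicalType) := g_sigma_algebraType (@open T).

(* A measure is only meaningful on Borel sets, so this definition is to be used
   on Hausdorff spaces, where compact sets are closed, hence Borel. *)
Definition is_radon {R : realType} (T : ptopologicalType)
    (mu : {measure set (borel T) -> \bar R}) : Prop :=
  [/\ forall C : set T, compact C -> (mu C < +oo)%E,
      forall U : set T, open U ->
        mu U = ereal_sup [set mu C | C in [set C : set T | compact C /\ C `<=` U]]
    & forall B : set (borel T), measurable B ->
        mu B = ereal_inf [set mu U | U in [set U : set T | open U /\ B `<=` U]]].

Section ScottFunctions.
Context {d : Order.disp_t} {K : tLatticeType d} {R : realType}.
Implicit Types (phi : K -> R) (z x : K) (s t : seq K).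

Definition scott_function phi : Prop :=
  [/\ forall x, 0 <= phi x,
      forall x, supremums [set phi z | z in [set z | way_below z x]] (phi x)
    & phi \top%O = 1].

Definition nabla1 z phi : K -> R := fun x => phi x - phi (x `&` z)%O.

(* [nabla [:: z1; ...; zn] phi = nabla1 zn (... (nabla1 z1 phi))] *)
Definition nabla s phi : K -> R := foldl (fun f z => nabla1 z f) phi s.

Definition completely_monotone phi : Prop :=
  {homo phi : x y / (x <= y)%O >-> x <= y} /\
  forall s, s != [::] -> forall x, 0 <= nabla s phi x.

Lemma nabla1C z z' phi : nabla1 z (nabla1 z' phi) = nabla1 z' (nabla1 z phi).
Proof.
apply/funext => x; rewrite /nabla1 -!meetA [(z' `&` z)%O]meetC.
by rewrite !opprB addrACA [RHS]addrACA; congr (_ + _); rewrite addrC.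
Qed.

Lemma nabla1_id z phi : nabla1 z (nabla1 z phi) = nabla1 z phi.
Proof. by apply/funext => x; rewrite /nabla1 -meetA meetxx subrr subr0. Qed.

(* [nabla s phi] depends only on the finite set of elements of [s], so that
   quantifying over nonempty sequences or nonempty finite sets is the same. *)
Lemma nabla_eq_mem s t phi : s =i t -> nabla s phi = nabla t phi.
Proof.
have nC z u f : nabla u (nabla1 z f) = nabla1 z (nabla u f).
  by elim: u f => //= y u IH f; rewrite nabla1C IH.
have nid z u f : z \in u -> nabla1 z (nabla u f) = nabla u f.
  elim: u f => //= y u IH f; rewrite in_cons => /orP[/eqP <-|]; last exact: IH.
  by rewrite nC nabla1_id.
have nU u f : nabla (undup u) f = nabla u f.
  elim: u f => //= y u IH f; case: ifP => /= yu; last exact: IH.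
  by rewrite IH nC nid.
have nrem z u f : z \in u -> nabla u f = nabla (z :: rem z u) f.
  elim: u f => //= y u IH f; rewrite in_cons eq_sym.
  case: (eqVneq y z) => [->//|_ /= zu]; rewrite IH //= nabla1C //.
have nP u v f : perm_eq u v -> nabla u f = nabla v f.
  elim: u v f => [|z u IH] v f uv; first by rewrite perm_sym in uv;
    rewrite (perm_nilP uv).
  have zv : z \in v by rewrite -(perm_mem uv) mem_head.
  rewrite (nrem z v) //=; apply: IH.
  by rewrite -(perm_cons z) (perm_trans uv) // perm_to_rem.
move=> st; rewrite -(nU s) -(nU t); apply: nP.
by apply: uniq_perm; rewrite ?undup_uniq // => x; rewrite !mem_undup.
Qed.

End ScottFunctions.

Definition represents {d : Order.disp_t} {K : tLatticeType d} {R : realType}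
    (mu : {measure set (borel (OFilt K)) -> \bar R}) (phi : K -> R) : Prop :=
  forall x : K, (phi x)%:E = mu [set V : OFilt K | ofilt_set V x].

(* Main.v *)
(* Write E_x for the set of filters containing x, and W_z for the open filter
   {x | z << x}.  If z << x then E_z is contained in the closed set of filters
   above W_z, which is contained in E_x; the Scott condition thus says exactly
   that phi x is approximated from within E_x by closed sets.

   For existence, complete monotonicity gives, for each finite list of elements
   x, a finite combination of point masses with the prescribed values on the
   E_x.  A limit of these along an ultrafilter is a finitely additive function m
   on all subsets with m E_x = phi x, and its closed inner content
   U |-> sup {m C | C closed, C <= U} on open sets is that of a Radon measure,
   by compactness.

   For uniqueness, a representing measure is determined on finite unions of the
   sets E_x minus finitely many E_a, and by compactness these approximate every
   open set from within. *)
From HB Require Import structures.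
Require Import Defs.
From mathcomp Require Import all_boot all_order all_algebra.
From mathcomp Require Import finmap.
From mathcomp Require Import all_classical all_reals all_analysis.

Set Implicit Arguments.
Unset Strict Implicit.
Unset Printing Implicit Defensive.

Import Order.TTheory GRing.Theory Num.Theory.
Import numFieldNormedType.Exports.

Local Open Scope classical_set_scope.
Local Open Scope ring_scope.

(** * Way-below and the Lawson topology on open filters *)

Section Domain.
Context {d : Order.disp_t} {P : porderType d} (P_domain : is_domain P).
Implicit Types x y z : P.

Lemma way_below_directed x : directed [set z | way_below z x].
Proof. by have [_ /(_ x)[]] := P_domain. Qed.

Lemma way_below_sup x : supremums [set z | way_below z x] x.
Proof. by have [_ /(_ x)[]] := P_domain. Qed.

Lemma way_below_le x y : way_below x y -> (x <= y)%O.
Proof. by move=> xy; have [+ _] := way_below_sup y; exact. Qed.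

Lemma way_below_lel x y z : (x <= y)%O -> way_below y z -> way_below x z.
Proof.
move=> xy yz E s dE Es /(yz E s dE Es)[w Ew yw].
by exists w => //; exact: le_trans yw.
Qed.

Lemma way_below_ler x y z : way_below x y -> (y <= z)%O -> way_below x z.
Proof. by move=> xy yz E s dE Es zs; apply: xy dE Es _; exact: le_trans zs. Qed.

Lemma way_below_nle x y : ~~ (x <= y)%O ->
  exists2 z, way_below z x & ~~ (z <= y)%O.
Proof.
move=> /negP xy; apply: contrapT => nz; apply: xy.
have [_] := way_below_sup x; apply => z zx /=.
by apply/negPn/negP => zy; apply: nz; exists z.
Qed.

(** The elements two way-below steps under [y] form a directed set [D] with supremum [y], so
    [way_below x y] puts [x] below a member of [D]. *)
Lemma way_below_interpolate x y : way_below x y ->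
  exists2 z, way_below x z & way_below z y.
Proof.
move=> xy; pose D := [set w | exists2 z, way_below w z & way_below z y].
have dD : directed D.
  split.
    have [[z zy] _] := way_below_directed y.
    by have [[w wz] _] := way_below_directed z; exists w, z.
  move=> a b [za aza zay] [zb bzb zby].
  have [_ /(_ za zb zay zby)[z [zy zaz zbz]]] := way_below_directed y.
  have [_] := way_below_directed z.
  move=> /(_ a b (way_below_ler aza zaz) (way_below_ler bzb zbz))[c [cz ac bc]].
  by exists c; split => //; exists z.
have supD : supremums D y.
  split=> [w [z wz zy]|u uD].
    exact: le_trans (way_below_le wz) (way_below_le zy).
  have [_] := way_below_sup y; apply => z zy.
  have [_] := way_below_sup z; apply => w wz.
  by apply: uD; exists z.
have [w [z wz zy] xw] := xy D y dD supD (lexx y).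
by exists z => //; exact: way_below_lel xw wz.
Qed.

Lemma scott_open_below (U : set P) x : scott_open U -> U x ->
  exists2 z, way_below z x & U z.
Proof.
move=> [_ oU] Ux.
have [z [zx Uz]] := oU _ _ (way_below_directed x) (way_below_sup x) Ux.
by exists z.
Qed.

Lemma scott_open_way_above z : scott_open [set x | way_below z x].
Proof.
split=> [x y xy zx|E s dE Es]; first exact: way_below_ler zx xy.
move=> /= /way_below_interpolate[y zy /(_ E s dE Es (lexx s))[w Ew yw]].
by exists w; split => //; exact: way_below_ler zy yw.
Qed.

End Domain.

(** * The Lawson topology on open filters: Hausdorff, compact, and its neighbourhoods *)

Section OFiltTopology.
Context {d : Order.disp_t} {K : tLatticeType d} (K_domain : is_domain K)
  (K_top : way_below (\top%O : K) \top%O)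
  (K_mult : multiplicative_way_below K).
Implicit Types (x y z : K) (V W : OFilt K).

Lemma ofiltP V : scott_open_filter (ofilt_set V).
Proof. by apply: set_mem; exact: valP V. Qed.

Lemma ofilt_scott_open V : scott_open (ofilt_set V).
Proof. by have [] := ofiltP V. Qed.

Lemma ofilt_le V x y : (x <= y)%O -> ofilt_set V x -> ofilt_set V y.
Proof. by have [] := ofilt_scott_open V => + _; apply. Qed.

Lemma ofilt_top V : ofilt_set V \top%O.
Proof. by have [[x Vx] _ _] := ofiltP V; apply: ofilt_le Vx; exact: lex1. Qed.

Lemma ofilt_meet V x y :
  ofilt_set V (x `&` y)%O <-> ofilt_set V x /\ ofilt_set V y.
Proof.
split=> [Vxy|[Vx Vy]].
  by split; apply: ofilt_le Vxy; [exact: leIl|exact: leIr].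
have [_ /(_ x y Vx Vy)[z [Vz zx zy]] _] := ofiltP V.
by apply: ofilt_le Vz; rewrite lexI zx zy.
Qed.

Lemma ofilt_leP V W : reflect (ofilt_set V `<=` ofilt_set W) (V <= W)%O.
Proof. by rewrite ofilt_leE; exact: asboolP. Qed.

Lemma ofilt_below V x : ofilt_set V x ->
  exists2 z, way_below z x & ofilt_set V z.
Proof.
by move=> Vx; apply: scott_open_below => //; exact: ofilt_scott_open.
Qed.

Lemma scott_open_filterP (U : set K) : U \top%O ->
  (forall x y, U x -> U y -> U (x `&` y)%O) -> scott_open U ->
  scott_open_filter U.
Proof.
move=> U1 UI oU; split => //; first by exists \top%O.
move=> x y Ux Uy; exists (x `&` y)%O.
by split; [exact: UI|exact: leIl|exact: leIr].
Qed.

Definition ofilt_of (U : set K) (fU : scott_open_filter U) : OFilt K :=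
  MkOFilt (mem_set fU).

Lemma way_below_top z : way_below z \top%O.
Proof. by apply: way_below_lel K_top; exact: lex1. Qed.

(** [K_top] puts the top element in the set, [K_mult] closes it under meets, and interpolation makes
    it Scott open. *)
Lemma way_above_filter z : scott_open_filter [set x | way_below z x].
Proof.
apply: scott_open_filterP; first exact: way_below_top.
  by move=> x y zx zy; have := K_mult zx zy; rewrite meetxx.
exact: scott_open_way_above.
Qed.

Definition way_above z : OFilt K := ofilt_of (way_above_filter z).

Definition containing x : set (OFilt K) := [set V | ofilt_set V x].

Lemma containing_top : containing \top%O = setT.
Proof. by apply/seteqP; split => // V _; exact: ofilt_top. Qed.

Lemma containingI x y : containing x `&` containing y = containing (x `&` y)%O.
Proof. by apply/seteqP; split => V /ofilt_meet. Qed.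

Lemma le_containing x y : (x <= y)%O -> containing x `<=` containing y.
Proof. by move=> xy V; exact: ofilt_le. Qed.

Lemma containing_sub_way_above z :
  containing z `<=` [set W | (way_above z <= W)%O].
Proof.
move=> W Wz; apply/ofilt_leP => x zx; apply: ofilt_le Wz.
exact: way_below_le zx.
Qed.

Lemma way_above_sub_containing z x : way_below z x ->
  [set W | (way_above z <= W)%O] `<=` containing x.
Proof. by move=> zx W /ofilt_leP; exact. Qed.

(** The union of a directed family of open filters is an open filter, so the supremum of the family
    is contained in it; hence an element of the supremum lies in some member. *)
Lemma scott_open_containing x : scott_open (containing x).
Proof.
split=> [V W /ofilt_leP + Vx|E S [[V0 EV0] dE] ES Sx]; first exact.
pose U := [set y | exists2 V, E V & ofilt_set V y].
have fU : scott_open_filter U.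
  apply: scott_open_filterP.
  - by exists V0 => //; exact: ofilt_top.
  - move=> y z [V EV Vy] [W EW Wz].
    have [T [ET /ofilt_leP VT /ofilt_leP WT]] := dE _ _ EV EW.
    by exists T => //; apply/ofilt_meet; split; [exact: VT|exact: WT].
  - split=> [y z yz [V EV Vy]|D s dD Ds [V EV Vs]].
      by exists V => //; exact: ofilt_le Vy.
    have [_ /(_ _ _ dD Ds Vs)[y [Dy Vy]]] := ofilt_scott_open V.
    by exists y; split => //; exists V.
have : (S <= ofilt_of fU)%O.
  have [_] := ES; apply => V EV; apply/ofilt_leP => y Vy.
  by exists V.
by move=> /ofilt_leP /(_ _ Sx)[V EV Vx]; exists V.
Qed.

Lemma open_lawson_subbase (U : set (OFilt K)) : lawson_subbase U -> open U.
Proof.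
move=> sU; exists [set U]; last by rewrite bigcup_set1.
move=> _ ->; exists [fset U]%fset; first by move=> A /fset1P ->; exact: mem_set.
by rewrite set_fset1 bigcap_set1.
Qed.

Lemma open_lawsonP (U : set (OFilt K)) W : open U -> U W ->
  exists F : seq (set (OFilt K)),
    [/\ forall A, A \in F -> lawson_subbase A /\ A W &
        [set V | forall A, A \in F -> A V] `<=` U].
Proof.
move=> [D Dsub <-] [B DB BW]; have [F Fsub BF] := Dsub _ DB.
exists (enum_fset F); split=> [A AF|].
  split; first by apply: set_mem; exact: Fsub.
  by move: BW; rewrite -BF; apply.
have BV (V : OFilt K) : (forall A : set (OFilt K), A \in F -> A V) ->
    (B : set (OFilt K)) V by move=> FV; rewrite -BF => A; exact: FV.
by move=> V FV; exists B => //; exact: BV.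
Qed.

Lemma open_containing x : open (containing x).
Proof. by apply: open_lawson_subbase; left; exact: scott_open_containing. Qed.

Lemma closed_above V : closed [set W | (V <= W)%O].
Proof. by rewrite -openC; apply: open_lawson_subbase; right; exists V. Qed.

(** If [x] lies in [V] but not in [W], choose [z] way below [x] in [V]. The closed set of filters
    above [way_above z] contains the open set [containing z] around [V] and misses [W]. *)
Lemma hausdorff_OFilt : hausdorff_space (OFilt K).
Proof.
have sep V W x : ofilt_set V x -> ~ ofilt_set W x ->
    exists A B : set (OFilt K),
      [/\ open_nbhs V A, open_nbhs W B & A `&` B = set0].
  move=> Vx nWx; have [z zx Vz] := ofilt_below Vx.
  exists (containing z), (~` [set T | (way_above z <= T)%O]); split.
  - by split => //; exact: open_containing.
  - split; first by rewrite openC; exact: closed_above.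
    by move=> /ofilt_leP /(_ x zx).
  - by apply/seteqP; split => // T [/containing_sub_way_above].
rewrite open_hausdorff => V W VW.
have [x [[Vx nWx]|[Wx nVx]]] : exists x,
    (ofilt_set V x /\ ~ ofilt_set W x) \/ (ofilt_set W x /\ ~ ofilt_set V x).
  apply: contrapT => nx; move/negP: VW; apply; apply/eqP/le_anti/andP.
  split; apply/ofilt_leP => x hx; apply: contrapT => nx'; apply: nx; exists x.
    by left.
  by right.
- have [A [B [[oA AV] [oB BW] AB]]] := sep V W x Vx nWx.
  by exists (A, B); rewrite !inE.
- have [A [B [[oA AV] [oB BW] AB]]] := sep W V x Wx nVx.
  by exists (B, A); rewrite /= ?inE; split => //; rewrite setIC.
Qed.

(** An ultrafilter [F] converges to the filter of those [x] that have some [z] way below them with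
    [containing z] in [F]; passing through [z] is what makes this filter Scott open. *)
Lemma compact_OFilt : compact [set: OFilt K].
Proof.
rewrite compact_ultra => F FU _.
pose U := [set x | exists2 z, way_below z x & F (containing z)].
have fU : scott_open_filter U.
  apply: scott_open_filterP.
  - by exists \top%O => //; rewrite containing_top; exact: filterT.
  - move=> x y [a ax Fa] [b b_y Fb]; exists (a `&` b)%O; first exact: K_mult.
    by rewrite -containingI; exact: filterI.
  - split=> [x y xy [z zx Fz]|E s dE Es [z zs Fz]].
      by exists z => //; exact: way_below_ler zx xy.
    have [_ /(_ _ _ dE Es zs)[x [Ex zx]]] := scott_open_way_above K_domain z.
    by exists x; split => //; exists z.
pose W := ofilt_of fU.
exists W; split => //.
have subF A : lawson_subbase A -> A W -> F A.
  case=> [[upA oA] AW|[V _ <-] VW].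
    (* [W] is the directed supremum of [E], so the Scott open set [A] contains some [way_above z]
       with [containing z] in [F], and then all of [containing z]. *)
    pose E := [set way_above z | z in [set z | F (containing z)]].
    have dE : directed E.
      split.
        exists (way_above \top%O), \top%O => //=.
        by rewrite containing_top; exact: filterT.
      move=> _ _ [a Fa <-] [b Fb <-].
      exists (way_above (a `&` b)%O); split.
      - by exists (a `&` b)%O => //=; rewrite -containingI; exact: filterI.
      - by apply/ofilt_leP => x; apply: way_below_lel; exact: leIl.
      - by apply/ofilt_leP => x; apply: way_below_lel; exact: leIr.
    have EW : supremums E W.
      split=> [_ [z Fz <-]|T ET].
        by apply/ofilt_leP => x zx; exists z.
      apply/ofilt_leP => x [z zx Fz].
      have /ofilt_leP : (way_above z <= T)%O by apply: ET; exists z.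
      exact.
    have [_ [[z Fz <-] Az]] := oA _ _ dE EW AW.
    by apply: filterS Fz => V /containing_sub_way_above; move/upA; exact.
  (* For [y] in [V] way below such an [x], [containing y] cannot belong to [F]; its complement does,
     and no filter there contains [V]. *)
  have [x [Vx nUx]] : exists x, ofilt_set V x /\ ~ U x.
    apply: contrapT => nx; apply: VW; apply/ofilt_leP => x Vx.
    by apply: contrapT => nUx; apply: nx; exists x.
  have [y yx Vy] := ofilt_below Vx.
  have [Fy|] := in_ultra_setVsetC (containing y) FU.
    by exfalso; apply: nUx; exists y.
  by apply: filterS => T nTy /ofilt_leP /(_ _ Vy).
move=> A; rewrite nbhsE => -[B [oB BW] BA]; apply: filterS BA _.
have [S [SW SB]] := open_lawsonP oB BW; apply: filterS SB _.
elim: S SW => [_|A0 S IH SW].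
  by apply: filterS filterT => V _ A1; rewrite in_nil.
have FA0 : F A0 by have [] := SW A0 (mem_head _ _); exact: subF.
have /IH FS : forall B0, B0 \in S -> lawson_subbase B0 /\ B0 W.
  by move=> B0 B0S; apply: SW; rewrite in_cons B0S orbT.
apply: filterS (filterI FA0 FS) => V [A0V SV] B0.
by rewrite in_cons => /orP[/eqP ->|/SV].
Qed.

(** The sets [A] need not be open, hence the conclusion [nbhs W A]. In the induction over subbasic
    sets, a Scott open set shrinks [x] to a meet and a complement adds one element to [s]. *)
Lemma open_containing_nbhs (U : set (OFilt K)) W : open U -> U W ->
  exists x (s : seq K),
    let A := containing x `\` \big[setU/set0]_(a <- s) containing a in
    A `<=` U /\ nbhs W A.
Proof.
move=> oU UW; have [S [SW SU]] := open_lawsonP oU UW.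
suff [x [s [sS nS]]] : exists x (s : seq K),
    let A := containing x `\` \big[setU/set0]_(a <- s) containing a in
    A `<=` [set V | forall A, A \in S -> A V] /\ nbhs W A.
  by exists x, s; split => //; exact: subset_trans SU.
elim: S SW {SU} => [_|A S IH SW].
  exists \top%O, [::] => /=; rewrite big_nil setD0 containing_top.
  by split => //; exact: filterT.
have {IH}[|x [s [xsS Wxs]]] := IH.
  by move=> B BS; apply: SW; rewrite in_cons BS orbT.
have [subA AW] := SW A (mem_head _ _).
suff [y [t [ytA [ytxs nyt]]]] : exists y (t : seq K),
    let B := containing y `\` \big[setU/set0]_(a <- t) containing a in
    B `<=` A /\ B `<=` containing x `\` \big[setU/set0]_(a <- s) containing a /\
    nbhs W B.
  exists y, t; split => // V yV B; rewrite in_cons => /orP[/eqP ->|].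
    exact: ytA.
  by apply: xsS; exact: ytxs.
case: subA AW => [[upA oA] AW|[V _ <-] /= VW].
  (* [W] is the directed supremum of the [way_above z] with [z] in [W], so one of them lies in
     [A]. *)
  pose E := [set way_above z | z in ofilt_set W].
  have dE : directed E.
    split; first by exists (way_above \top%O), \top%O => //; exact: ofilt_top.
    move=> _ _ [a Wa <-] [b Wb <-].
    exists (way_above (a `&` b)%O); split.
    - by exists (a `&` b)%O => //=; exact/ofilt_meet.
    - by apply/ofilt_leP => y; apply: way_below_lel; exact: leIl.
    - by apply/ofilt_leP => y; apply: way_below_lel; exact: leIr.
  have EW : supremums E W.
    split=> [_ [z Wz <-]|T ET].
      exact: containing_sub_way_above.
    apply/ofilt_leP => y /ofilt_below[z zy Wz].
    have /ofilt_leP : (way_above z <= T)%O by apply: ET; exists z.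
    exact.
  have [_ [[z Wz <-] Az]] := oA _ _ dE EW AW.
  exists (z `&` x)%O, s => /=; split.
    move=> T [/ofilt_meet[Tz _] _]; move: Az; apply: upA.
    exact: containing_sub_way_above.
  split; first by apply: setSD; apply: le_containing; exact: leIr.
  rewrite -containingI -setIDA; apply: filterI => //.
  by apply: open_nbhs_nbhs; split => //; exact: open_containing.
have [y [Vy nWy]] : exists y, ofilt_set V y /\ ~ ofilt_set W y.
  apply: contrapT => ny; apply: VW; apply/ofilt_leP => y Vy.
  by apply: contrapT => nWy; apply: ny; exists y.
(* With [z] way below [y], the filters above [way_above z] form a closed set missing [W] and
   containing [containing z]; so removing [containing z] leaves a neighbourhood of [W]. *)
have [z zy Vz] := ofilt_below Vy.
exists x, (z :: s); rewrite /= big_cons.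
split; first by move=> T [_ nT] /ofilt_leP /(_ _ Vz) Tz; apply: nT; left.
split; first by apply: setDS; exact: subsetUr.
rewrite setDE setCU setIA (setIC _ (~` containing z)) -setIA -setDE.
apply: filterI => //.
have : nbhs W (~` [set T | (way_above z <= T)%O]).
  apply: open_nbhs_nbhs; split; first by rewrite openC; exact: closed_above.
  by move=> /ofilt_leP /(_ y zy).
by apply: filterS; apply: subsetC; exact: containing_sub_way_above.
Qed.

End OFiltTopology.

(** * Finitely additive extension *)

(** The domain is all subsets, so point masses and ultrafilter limits need no algebra of sets. *)
Definition finitely_additive {T : Type} {R : realType} (m : set T -> R) :=
  (forall A, 0 <= m A) /\
  (forall A B, A `&` B = set0 -> m (A `|` B) = m A + m B).

Section FinitelyAdditive.
Context {T : Type} {R : realType}.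
Implicit Types (m : set T -> R) (A B : set T).

Lemma finitely_additive0 m : finitely_additive m -> m set0 = 0.
Proof.
move=> [_ mD]; have := mD set0 set0; rewrite setI0 setU0 => /(_ erefl)/eqP.
by rewrite -subr_eq0 opprD addNKr oppr_eq0 => /eqP.
Qed.

Lemma finitely_additive_le m A B :
  finitely_additive m -> A `<=` B -> m A <= m B.
Proof.
move=> [m0 mD] /setUidPr AB; have : m (A `|` (B `\` A)) = m A + m (B `\` A).
  by apply: mD; rewrite setDE setICA setICr setI0.
by rewrite setUDr setDv setD0 AB => ->; rewrite lerDl.
Qed.

Lemma finitely_additiveU m A B : finitely_additive m ->
  m (A `|` B) <= m A + m B.
Proof.
move=> fm; have [m0 mD] := fm; rewrite -(setDUK (@subsetUl _ A B)) mD.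
  by rewrite lerD2l; apply: finitely_additive_le => // x [[//|]].
by rewrite setDE setICA setICr setI0.
Qed.

Lemma finitely_additiveD m1 m2 : finitely_additive m1 -> finitely_additive m2 ->
  finitely_additive (fun A => m1 A + m2 A).
Proof.
move=> [p1 a1] [p2 a2]; split=> [A|A B AB]; first exact: addr_ge0.
by rewrite a1 // a2 // addrACA.
Qed.

Lemma finitely_additive_point (c : R) (p : T) : 0 <= c ->
  finitely_additive (fun A => c * (p \in A)%:R).
Proof.
move=> c0; split=> [A|A B AB]; first by rewrite mulr_ge0.
rewrite in_setU -mulrDr -natrD; congr (c * _%:R).
case: (boolP (p \in A)) => [/set_mem Ap|_] //=.
case: (boolP (p \in B)) => //= /set_mem Bp.
by have : (A `&` B) p by []; rewrite AB.
Qed.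

(** The values cluster in the compact segment from [0] to [c], and an ultrafilter converges to each
    of its cluster points. *)
Lemma ultra_bounded_cvg {I : Type} (F : set_system I) (f : I -> R) (c : R) :
  UltraFilter F -> (forall i, 0 <= f i <= c) -> cvg (f @ F).
Proof.
move=> FU fc.
have : (f @ F) `[0, c]%classic.
  by apply: (@filterS _ F _ setT _ _ filterT) => i _ /=; rewrite in_itv /=.
move=> /(@segment_compact R 0 c (f @ F) _)[l [_ lF]].
apply/cvg_ex; exists l => N Nl.
have [//|FN] := in_ultra_setVsetC (f @^-1` N) FU.
have : (f @ F) (~` N) by [].
by move=> /lF /(_ Nl)[x []].
Qed.

(** The pointwise limit inherits additivity, and a value attained on a member of [F] is kept
    exactly. *)
Lemma finitely_additive_ultra {I : Type} (F : set_system I)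
    (m : I -> set T -> R) (c : R) : UltraFilter F ->
  (forall i, finitely_additive (m i)) -> (forall i, m i setT <= c) ->
  exists2 l : set T -> R, finitely_additive l &
    forall A r, F [set i | m i A = r] -> l A = r.
Proof.
move=> FU fm mc.
have mcvg A : cvg (m ^~ A @ F).
  apply: (@ultra_bounded_cvg _ F _ c) => i; have [m0 _] := fm i.
  by rewrite m0 (le_trans _ (mc i)) //; exact: finitely_additive_le.
exists (fun A => lim (m ^~ A @ F)).
  split=> [A|A B AB].
    apply: limr_ge => //; apply: filterS filterT => i _.
    by have [+ _] := fm i; apply.
  apply/cvg_lim => //.
  rewrite [X in X @ F](_ : _ = (m ^~ A) \+ (m ^~ B)); last first.
    by apply/funext => i /=; have [_ ->] := fm i.
  exact: cvgD.
move=> A r Fr; apply: lim_near_cst => //.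
Qed.

End FinitelyAdditive.

(** * Iterated differences *)

Section CompletelyMonotone.
Context {d : Order.disp_t} {K : tLatticeType d} {R : realType}.
Implicit Types (f : K -> R) (x z a : K) (s t u v : seq K).

(** Allowing the empty list makes nonnegativity of [f] part of the condition; singletons give
    monotonicity. *)
Definition nabla_nonneg f := forall v x, 0 <= nabla v f x.

Lemma nabla_translate v f z x :
  nabla v (fun y => f (y `&` z)%O) x = nabla v f (x `&` z)%O.
Proof.
elim: v f x => //= a v IH f x; rewrite -IH; congr (nabla v _ x).
by apply/funext => y; rewrite /nabla1 meetAC.
Qed.

Lemma nabla_nonneg_le f x y : nabla_nonneg f -> (x <= y)%O -> f x <= f y.
Proof.
by move=> f0 xy; have := f0 [:: x] y; rewrite /= /nabla1 (meet_r xy) subr_ge0.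
Qed.

Lemma nabla_nonneg_translate f z : nabla_nonneg f ->
  nabla_nonneg (fun y => f (y `&` z)%O).
Proof. by move=> f0 v x; rewrite nabla_translate. Qed.

Lemma nabla_nonneg_nabla1 f z : nabla_nonneg f -> nabla_nonneg (nabla1 z f).
Proof. by move=> f0 v x; exact: (f0 (z :: v) x). Qed.

End CompletelyMonotone.

(** * Finite combinations of point masses and their limit *)

Section DiscreteApproximation.
Context {d : Order.disp_t} {K : tLatticeType d} (K_domain : is_domain K)
  (K_top : way_below (\top%O : K) \top%O)
  (K_mult : multiplicative_way_below K) {R : realType}.
Implicit Types (f : K -> R) (x z a : K) (s t u : seq K).

(** Each [a] is avoided by some element way below [x]; directedness gives one [z] avoiding them all,
    and [way_above z] is the filter sought. *)
Lemma ofilt_separate x u : (forall a, a \in u -> ~~ (x <= a)%O) ->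
  exists W : OFilt K, containing x W /\ forall a, a \in u -> ~ containing a W.
Proof.
move=> xu.
suff [z zx zu] : exists2 z, way_below z x & forall a, a \in u -> ~~ (z <= a)%O.
  exists (way_above K_domain K_top K_mult z); split => // a au za.
  by have /negP := zu a au; apply; exact: way_below_le za.
elim: u xu => [_|b u IH xu].
  by have [[z zx] _] := way_below_directed K_domain x; exists z.
have [|z zx zu] := IH; first by move=> a au; apply: xu; rewrite in_cons au orbT.
have [y yx yb] := way_below_nle K_domain (xu b (mem_head _ _)).
have [_ /(_ z y zx yx)[w [wx zw yw]]] := way_below_directed K_domain x.
exists w => // a; rewrite in_cons => /orP[/eqP ->|/zu].
  by apply: contra yb; exact: le_trans.
by apply: contra; exact: le_trans.
Qed.

(* Splitting f as f(. /\ z) + nabla_z f for every z in the list leaves pieces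
   for which each E_z carries either everything or nothing; such a piece is a
   point mass. *)
Lemma finitely_additive_split s t u f : nabla_nonneg f ->
  (forall z, z \in t -> forall x, f (x `&` z)%O = f x) ->
  (forall a, a \in u -> f a = 0) ->
  exists2 m : set (OFilt K) -> R, finitely_additive m &
    forall x, x \in s ++ t ++ u -> m (containing x) = f x.
Proof.
elim: s t u f => [|z s IH] t u f f0 ft fu.
  have [f1|f1] := eqVneq (f \top%O) 0.
    exists (fun=> 0); first by split => // A B _; rewrite addr0.
    move=> x _; apply/eqP; rewrite eq_sym eq_le (f0 [::]) andbT -f1.
    by apply: nabla_nonneg_le => //; exact: lex1.
  (* Meeting with members of [t] does not change [f], so [f y] is the nonzero total mass. Hence [y]
     is below no element of [u], and all the mass can sit at one filter that contains [y] and misses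
     [u]. *)
  pose y := \big[Order.meet / \top%O]_(z <- t) z.
  have fy : f y = f \top%O.
    rewrite -(meet1x y) /y; elim: (t) ft => [|z t' IHt] ft.
      by rewrite big_nil meetxx.
    rewrite big_cons meetCA meetC ft ?mem_head //; apply: IHt => x xt.
    by apply: ft; rewrite in_cons xt orbT.
  have ty x : x \in t -> (y <= x)%O.
    move=> xt; rewrite /y (big_rem x) //=; exact: leIl.
  have [|W [Wy Wu]] := @ofilt_separate y u.
    move=> a au; apply: contraNN f1 => ya.
    by rewrite -fy eq_le (f0 [::]) andbT -(fu a au) nabla_nonneg_le.
  exists (fun A => f \top%O * (W \in A)%:R).
    by apply: finitely_additive_point; exact: (f0 [::]).
  move=> x; rewrite cat0s mem_cat => /orP[xt|xu].
    rewrite mem_set; last by apply: le_containing Wy; exact: ty.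
    by rewrite mulr1 -(ft x xt) meet1x.
  by rewrite memNset ?mulr0 ?fu //; exact: Wu.
(* The first summand is unchanged by a further meet with [z], so [z] joins [t]. *)
have [||m1 fm1 m1E] := IH (z :: t) u _ (nabla_nonneg_translate z f0).
- move=> y + x; rewrite in_cons meetAC => /orP[/eqP ->|/ft ->//].
  by rewrite -meetA meetxx.
- move=> a /fu fa; apply/eqP; rewrite eq_le (f0 [::]) andbT -fa.
  by apply: nabla_nonneg_le => //; exact: leIl.
(* The second summand vanishes at [z], so [z] joins [u]. *)
have [||m2 fm2 m2E] := IH t (z :: u) _ (nabla_nonneg_nabla1 z f0).
- by move=> y /ft fy x; rewrite /nabla1 fy meetAC fy.
- move=> a; rewrite in_cons /nabla1 => /orP[/eqP ->|/fu fa].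
    by rewrite meetxx subrr.
  rewrite fa sub0r; apply/eqP; rewrite oppr_eq0 eq_le (f0 [::]) andbT -fa.
  by apply: nabla_nonneg_le => //; exact: leIl.
exists (fun A => m1 A + m2 A); first exact: finitely_additiveD.
move=> x xs; rewrite m1E ?m2E.
- by rewrite /nabla1 addrC subrK.
- by move: xs; rewrite !(mem_cat, in_cons); do !case: (_ \in _); do ?case: eqP.
- by move: xs; rewrite !(mem_cat, in_cons); do !case: (_ \in _); do ?case: eqP.
Qed.

Lemma finitely_additive_extension f : nabla_nonneg f ->
  exists2 m : set (OFilt K) -> R, finitely_additive m &
    forall x, m (containing x) = f x.
Proof.
move=> f0.
(* Adding the top element to each list fixes the total mass at [f \top], the uniform bound needed
   for the limit. *)
have /choice[m mP] : forall s, exists m : set (OFilt K) -> R,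
    finitely_additive m /\
    forall x, x \in \top%O :: s -> m (containing x) = f x.
  move=> s.
  have [z|a|m fm mE] := @finitely_additive_split (\top%O :: s) [::] [::] f f0.
  - by rewrite in_nil.
  - by rewrite in_nil.
  by exists m; split => // x xs; apply: mE; rewrite !cats0.
(* Along this filter every [x] eventually belongs to the list, so the limit takes the exact value
   [f x] on [containing x]. *)
pose F := filter_from setT (fun s : seq K => [set t : seq K | {subset s <= t}]).
have FF : ProperFilter F.
  apply: filter_from_proper => [|s _]; last by exists s.
  apply: filter_from_filter; first by exists [::].
  move=> s t _ _; exists (s ++ t) => // v stv.
  by split=> x xs; apply: stv; rewrite mem_cat xs ?orbT.
have [G [GU FG]] := ultraFilterLemma FF.
have [||l fl lE] := @finitely_additive_ultra _ R _ G m (f \top%O) GU.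
- by move=> s; have [] := mP s.
- by move=> s; have [_ mE] := mP s; rewrite -containing_top mE ?mem_head.
exists l => // x; apply: lE; apply: FG; exists [:: x] => // s xs.
by have [_ mE] := mP s; apply: mE; rewrite in_cons xs ?orbT ?mem_head.
Qed.

End DiscreteApproximation.

(** * Radon measures from finitely additive functions *)

Section Regularization.
Context {T : ptopologicalType} {R : realType} (m : set T -> R)
  (hausdorffT : hausdorff_space T) (compactT : compact [set: T])
  (fm : finitely_additive m).
Implicit Types (A B C U V : set T).
Local Open Scope ereal_scope.

Definition inner_content U : \bar R :=
  ereal_sup [set (m C)%:E | C in [set C | closed C /\ C `<=` U]].

Definition outer_content B : \bar R :=
  ereal_inf [set inner_content U | U in [set U | open U /\ B `<=` U]].

Lemma closed_inner_content C U : closed C -> C `<=` U ->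
  (m C)%:E <= inner_content U.
Proof. by move=> cC CU; apply: ereal_sup_ubound; exists C. Qed.

Lemma inner_contentP U x :
  (forall C, closed C -> C `<=` U -> (m C)%:E <= x) -> inner_content U <= x.
Proof. by move=> ux; apply: ge_ereal_sup => _ [C [cC CU] <-]; exact: ux. Qed.

Lemma inner_content_le_content U : inner_content U <= (m U)%:E.
Proof.
apply: inner_contentP => C _ CU; rewrite lee_fin.
exact: finitely_additive_le.
Qed.

Lemma inner_content_ge0 U : 0 <= inner_content U.
Proof.
rewrite -(_ : (m set0)%:E = 0); last by rewrite finitely_additive0.
by apply: closed_inner_content => //; exact: closed0.
Qed.

Lemma inner_content_fin_num U : inner_content U \is a fin_num.
Proof.
rewrite ge0_fin_numE ?inner_content_ge0 //.
by rewrite (le_lt_trans (inner_content_le_content U)) // ltry.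
Qed.

Lemma le_inner_content U V : U `<=` V -> inner_content U <= inner_content V.
Proof.
move=> UV; apply: inner_contentP => C cC CU; apply: closed_inner_content => //.
exact: subset_trans UV.
Qed.

(** By normality, disjoint open sets [G] and [H] separate the disjoint closed sets [C] minus [U] and
    [C] minus [V]. Removing [G] or [H] from [C] gives closed pieces inside [U] and [V] that together
    cover [C]. *)
Lemma inner_contentU U V : open U -> open V ->
  inner_content (U `|` V) <= inner_content U + inner_content V.
Proof.
move=> oU oV; apply: inner_contentP => C cC CUV.
have cD W : open W -> closed (C `\` W).
  by move=> oW; rewrite setDE; apply: closedI => //; exact: open_closedC.
have disj : (C `\` U) `&` (C `\` V) = set0.
  by apply/seteqP; split => // x [[Cx nU] [_ nV]]; case: (CUV x Cx).
have [G [H [oG oH CG CH GH]]] :=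
  (@normal_openP R T).1 (compact_normal hausdorffT compactT)
    _ _ (cD _ oU) (cD _ oV) disj.
have CE : C `<=` (C `\` G) `|` (C `\` H).
  move=> x Cx; have [Gx|nGx] := pselect (G x); last by left.
  by right; split => // Hx; have : (G `&` H) x by []; rewrite GH.
apply: (@le_trans _ _ ((m (C `\` G))%:E + (m (C `\` H))%:E)).
  rewrite -EFinD lee_fin (le_trans (finitely_additive_le fm CE)) //.
  exact: finitely_additiveU.
apply: leeD; apply: closed_inner_content (cD _ _) _ => // x [Cx nx].
  by apply: contrapT => nU; apply: nx; apply: CG.
by apply: contrapT => nU; apply: nx; apply: CH.
Qed.

Lemma inner_content_bigcup (U : (set T)^nat) : (forall n, open (U n)) ->
  inner_content (\bigcup_n U n) <= \sum_(n <oo) inner_content (U n).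
Proof.
move=> oU; apply: inner_contentP => C cC CU.
have : compact C by apply: subclosed_compact compactT _.
rewrite compact_cover => /(_ nat setT U (fun n _ => oU n) CU)[D _ CD].
(* The successor is needed because the union below runs over [i < N]. *)
pose N := (\max_(i <- D) i).+1.
have CN : C `<=` \big[setU/set0]_(i < N) U i.
  move=> x /CD[i /= iD Uix]; rewrite -bigcup_mkord; exists i => //=.
  by rewrite ltnS; exact: leq_bigmax_seq.
apply: le_trans (nneseries_lim_ge N _); last first.
  by move=> *; exact: inner_content_ge0.
apply: (@le_trans _ _ (inner_content (\big[setU/set0]_(i < N) U i))).
  exact: closed_inner_content.
rewrite big_mkord; elim: (N) => [|k IH].
  rewrite !big_ord0 (le_trans (inner_content_le_content _)) //.
  by rewrite finitely_additive0.
rewrite !big_ord_recr /=.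
apply: le_trans (inner_contentU _ _) (leeD IH (lexx _)) => //.
by rewrite -bigcup_mkord; exact: bigcup_open.
Qed.

Lemma outer_content_open U : open U -> outer_content U = inner_content U.
Proof.
move=> oU; apply/eqP; rewrite eq_le; apply/andP; split.
  by apply: ereal_inf_lbound; exists U => //; split => //; exact: subset_refl.
by apply: le_ereal_inf_tmp => _ [V [oV UV] <-]; exact: le_inner_content.
Qed.

Lemma outer_content_le B U : open U -> B `<=` U ->
  outer_content B <= inner_content U.
Proof. by move=> oU BU; apply: ereal_inf_lbound; exists U. Qed.

Lemma outer_content_ge0 B : 0 <= outer_content B.
Proof. by apply: le_ereal_inf_tmp => _ [U _ <-]; exact: inner_content_ge0. Qed.

Lemma outer_content_fin_num B : outer_content B \is a fin_num.
Proof.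
rewrite ge0_fin_numE ?outer_content_ge0 //.
apply: le_lt_trans (outer_content_le openT (@subsetT _ _)) _.
by rewrite -ge0_fin_numE ?inner_content_fin_num ?inner_content_ge0.
Qed.

Lemma outer_content0 : outer_content set0 = 0.
Proof.
apply/eqP; rewrite eq_le outer_content_ge0 andbT.
rewrite outer_content_open; last exact: open0.
by rewrite (le_trans (inner_content_le_content _)) // finitely_additive0.
Qed.

Lemma le_outer_content : {homo outer_content : A B / A `<=` B >-> A <= B}.
Proof.
move=> A B AB; apply: le_ereal_inf_tmp => _ [U [oU BU] <-].
by apply: outer_content_le => //; exact: subset_trans BU.
Qed.

(** Open sets [U n] approximate [B n] from outside with errors summing to [e], which reduces the
    claim to countable unions of open sets. *)
Lemma outer_content_sigma_subadditive : sigma_subadditive outer_content.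
Proof.
move=> B; apply/lee_addgt0Pr => e e0.
have B0 n := outer_content_ge0 (B n).
apply: le_trans (epsilon_trick xpredT B0 (ltW e0)).
have /choice[U UP] : forall n, exists U, [/\ open U, B n `<=` U &
    inner_content U <= outer_content (B n) + (e / (2 ^ n.+1)%:R)%:E].
  move=> n; have en : (0 < e / (2 ^ n.+1)%:R)%R.
    by rewrite divr_gt0 // ltr0n expn_gt0.
  have [_ [U [oU BU] <-] /ltW] :=
    lb_ereal_inf_adherent en (outer_content_fin_num (B n)).
  by exists U.
apply: (@le_trans _ _ (inner_content (\bigcup_n U n))).
  apply: outer_content_le; first by apply: bigcup_open => n _; have [] := UP n.
  by apply: subset_bigcup => n _; have [] := UP n.
apply: le_trans (inner_content_bigcup _) _; first by move=> n; have [] := UP n.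
apply: lee_nneseries => [n _ _|n _]; first exact: inner_content_ge0.
by have [] := UP n.
Qed.

Lemma closed_outer_content C : closed C -> (m C)%:E <= outer_content C.
Proof.
move=> cC; apply: le_ereal_inf_tmp => _ [U [_ CU] <-].
exact: closed_inner_content.
Qed.

(** For open [V] containing [X], let a closed [C] nearly exhaust [V] within [U]. The rest of [X]
    lies in [V] minus [C], and a closed [D] there is disjoint from [C], so their union competes in
    [inner_content V]. *)
Lemma outer_content_caratheodory U : open U -> forall X,
  outer_content (X `&` U) + outer_content (X `&` ~` U) <= outer_content X.
Proof.
move=> oU X; apply: le_ereal_inf_tmp => _ [V [oV XV] <-].
have oVU : open (V `&` U) by exact: openI.
apply: (@le_trans _ _ (inner_content (V `&` U) + outer_content (X `&` ~` U))).
  by rewrite leeD2r // outer_content_le //; exact: setSI.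
apply/lee_addgt0Pr => e e0.
have [_ [C [cC CVU] <-]] :=
  ub_ereal_sup_adherent e0 (inner_content_fin_num (V `&` U)).
rewrite lteBlDr // => /ltW VUC.
apply: (@le_trans _ _ ((m C)%:E + e%:E + inner_content (V `\` C))).
  apply: leeD => //; apply: outer_content_le.
    by rewrite setDE; apply: openI => //; exact: closed_openC.
  by move=> x [Xx nUx]; split; [exact: XV|move=> /CVU[]].
rewrite addeAC leeD2r // addeC -leeBrDr //.
apply: inner_contentP => D cD DVC; rewrite leeBrDr // -EFinD.
have [_ <-] := fm.
  apply: closed_inner_content; first exact: closedU.
  by move=> x [/DVC[]|/CVU[]].
by apply/seteqP; split => // x [/DVC[]].
Qed.

(** Open sets are Caratheodory measurable for [outer_content], hence so are all Borel sets, and the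
    outer measure restricts to a measure. *)
Lemma radon_regularization : exists mu : {measure set (borel T) -> \bar R},
  is_radon mu /\ forall U : set T, open U -> mu U = inner_content U.
Proof.
pose outer : {outer_measure set T -> \bar R} := HB.pack outer_content
  (isOuterMeasure.Build R T outer_content outer_content0 outer_content_ge0
    le_outer_content outer_content_sigma_subadditive).
have borelC (B : set (borel T)) : measurable B -> outer.-caratheodory B.
  have : <<s @open T >> `<=` outer.-caratheodory.
    apply: smallest_sub.
      split.
      - exact: caratheodory_measurable_set0.
      - by move=> A cA; rewrite setTD; exact: caratheodory_measurable_setC.
      - by move=> F cF; exact: caratheodory_measurable_bigcup.
    move=> U oU; apply: le_caratheodory_measurable.
    exact: outer_content_caratheodory.
  exact.
have sadd : semi_sigma_additive (outer_content : set (borel T) -> \bar R).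
  move=> F mF tF mUF.
  apply: (@caratheodory_measure_sigma_additive R T outer) => //.
  - by move=> n; exact: borelC.
  - exact: borelC.
pose mu : {measure set (borel T) -> \bar R} := HB.pack
  (outer_content : set (borel T) -> \bar R)
  (isMeasure.Build _ (borel T) R (outer_content : set (borel T) -> \bar R)
    outer_content0 outer_content_ge0 sadd).
exists mu; split; last exact: outer_content_open.
have muE : mu = outer_content :> (set T -> \bar R) by [].
split.
- move=> C _; rewrite muE -ge0_fin_numE ?outer_content_fin_num //.
  exact: outer_content_ge0.
(* Closed sets are compact here, and the measure of a closed [C] is at least [m C]. *)
- move=> U oU; rewrite muE; apply/eqP; rewrite eq_le; apply/andP; split.
    rewrite outer_content_open //; apply: inner_contentP => C cC CU.
    apply: le_trans (closed_outer_content cC) _; apply: ereal_sup_ubound.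
    exists C => //; split => //; exact: subclosed_compact compactT _.
  by apply: ge_ereal_sup => _ [C [_ CU] <-]; exact: le_outer_content.
- move=> B _; rewrite muE {1}/outer_content; congr ereal_inf.
  by apply: eq_imagel => U [oU _]; rewrite outer_content_open.
Qed.

End Regularization.

(** * Representing measures *)

Section Representation.
Context {d : Order.disp_t} {K : tLatticeType d} (K_domain : is_domain K)
  (K_top : way_below (\top%O : K) \top%O)
  (K_mult : multiplicative_way_below K) {R : realType}.
Implicit Types (phi : K -> R) (x z : K) (s : seq K) (p : K * seq K).
Implicit Types mu nu : {measure set (borel (OFilt K)) -> \bar R}.

Definition basic_set p : set (borel (OFilt K)) :=
  containing p.1 `\` \big[setU/set0]_(a <- p.2) containing a.

Lemma measurable_open (U : set (OFilt K)) :
  open U -> measurable (U : set (borel (OFilt K))).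
Proof. by move=> oU; exact: sub_sigma_algebra. Qed.

Lemma measurable_compact (C : set (OFilt K)) :
  compact C -> measurable (C : set (borel (OFilt K))).
Proof.
move=> cC; rewrite -[C]setCK; apply: measurableC; apply: measurable_open.
by apply: closed_openC; apply: compact_closed cC; exact: hausdorff_OFilt.
Qed.

Lemma measurable_containing x :
  measurable (containing x : set (borel (OFilt K))).
Proof. by apply: measurable_open; exact: open_containing. Qed.

Lemma measurable_basic_set p : measurable (basic_set p).
Proof.
apply: measurableD; first exact: measurable_containing.
by apply: bigsetU_measurable => a _; exact: measurable_containing.
Qed.

Lemma basic_setI p q :
  basic_set p `&` basic_set q = basic_set ((p.1 `&` q.1)%O, p.2 ++ q.2).
Proof.
by rewrite /basic_set /= big_cat /= -containingI !setDE setCU setIACA.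
Qed.

Lemma represents_basic_set mu phi p : represents mu phi ->
  mu (basic_set p) = (nabla p.2 phi p.1)%:E.
Proof.
move=> rep; case: p => x s; rewrite /basic_set /=.
(* [B] collects what has already been removed and [f] is the difference reached so far; removing
   [containing z] as well turns [f] into [nabla1 z f]. *)
suff H (B : set (borel (OFilt K))) (f : K -> R) : measurable B ->
    (forall y, mu (containing y `\` B) = (f y)%:E) ->
    mu (containing x `\` (B `|` \big[setU/set0]_(a <- s) containing a)) =
      (nabla s f x)%:E.
  rewrite -[X in _ `\` X]set0U; apply: H => [|y]; first exact: measurable0.
  by rewrite setD0 -rep.
elim: s B f => [|z s IH] B f mB Bf; first by rewrite big_nil setU0 Bf.
rewrite big_cons setUA; apply: IH => [|y].
  by apply: measurableU => //; exact: measurable_containing.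
have mD : measurable (containing y `\` B : set (borel (OFilt K))).
  by apply: measurableD => //; exact: measurable_containing.
rewrite -setDDl measureD //; last 2 first.
- exact: measurable_containing.
- by have := ltry (f y); rewrite -Bf.
rewrite /nabla1 EFinB -!Bf -containingI; congr (_ - mu _)%E.
by rewrite !setDE setIAC.
Qed.

Lemma represents_le_top mu phi (A : set (borel (OFilt K))) :
  represents mu phi -> measurable A -> (mu A <= (phi \top%O)%:E)%E.
Proof.
move=> rep mA; rewrite rep; apply: le_measure; rewrite ?inE //.
  exact: measurable_containing.
by move=> V _; exact: ofilt_top.
Qed.

(** Inclusion-exclusion on the first set. The intersection term is a union over [L'], a different
    list of the same length as [L], so the induction is on length. *)
Lemma represents_basic_union_unique mu nu phi (L : seq (K * seq K)) :
  represents mu phi -> represents nu phi ->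
  mu (\big[setU/set0]_(p <- L) basic_set p) =
  nu (\big[setU/set0]_(p <- L) basic_set p).
Proof.
move=> rmu rnu; have [n] := ubnP (size L); elim: n L => // n IH [|p L] Ln.
  by rewrite !big_nil !measure0.
have mU M : measurable (\big[setU/set0]_(q <- M) basic_set q).
  by apply: bigsetU_measurable => q _; exact: measurable_basic_set.
pose L' := [seq ((p.1 `&` r.1)%O, p.2 ++ r.2) | r <- L].
have IL : basic_set p `&` \big[setU/set0]_(q <- L) basic_set q =
    \big[setU/set0]_(q <- L') basic_set q.
  rewrite /L' big_map big_distrr /=.
  by apply: eq_bigr => q _; rewrite basic_setI.
have E la : represents la phi ->
    la (\big[setU/set0]_(q <- p :: L) basic_set q) =
    (la (basic_set p) + la (\big[setU/set0]_(q <- L) basic_set q) -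
     la (\big[setU/set0]_(q <- L') basic_set q))%E.
  move=> rla; rewrite big_cons measureUfinl ?IL //.
  - exact: measurable_basic_set.
  - apply: le_lt_trans (represents_le_top rla (measurable_basic_set p)) _.
    exact: ltry.
rewrite !E // (represents_basic_set p rmu) (represents_basic_set p rnu).
by rewrite !IH ?size_map.
Qed.

Lemma compact_basic_cover (C U : set (OFilt K)) :
  compact C -> open U -> C `<=` U ->
  exists L : seq (K * seq K), C `<=` \big[setU/set0]_(p <- L) basic_set p /\
    \big[setU/set0]_(p <- L) basic_set p `<=` U.
Proof.
move=> cC oU CU; move: cC; rewrite compact_cover.
pose D := [set p : K * seq K | basic_set p `<=` U].
(* The cover uses interiors because basic sets need not be open. *)
move=> /(_ (K * seq K)%type D (fun p => (basic_set p : set (OFilt K))°)).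
case=> [p _|V CV|L LD CL]; first exact: open_interior.
  have [x [s [sU nV]]] :=
    open_containing_nbhs K_domain K_top K_mult oU (CU V CV).
  by exists (x, s).
exists (enum_fset L); split.
  move=> V /CL[p /= pL pV]; rewrite -bigcup_seq; exists p => //.
  exact: interior_subset pV.
by rewrite -bigcup_seq => V [p /= /LD /set_mem]; exact.
Qed.

(** Between a compact subset of [U] and [U] itself fits a finite union of basic sets, on which [mu]
    and [nu] agree. *)
Lemma represents_le_open mu nu phi (U : set (OFilt K)) :
  is_radon nu -> represents mu phi -> represents nu phi -> open U ->
  (nu U <= mu U)%E.
Proof.
move=> [_ innu _] rmu rnu oU; rewrite innu //.
apply: ge_ereal_sup => _ [C [cC CU] <-].
have [L [CL LU]] := compact_basic_cover cC oU CU.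
have mL : measurable (\big[setU/set0]_(p <- L) basic_set p).
  by apply: bigsetU_measurable => q _; exact: measurable_basic_set.
apply: (@le_trans _ _ (nu (\big[setU/set0]_(p <- L) basic_set p))).
  by apply: le_measure; rewrite ?inE //; exact: measurable_compact.
rewrite -(represents_basic_union_unique L rmu rnu).
by apply: le_measure; rewrite ?inE //; exact: measurable_open.
Qed.

Lemma represents_unique mu nu phi : is_radon mu -> is_radon nu ->
  represents mu phi -> represents nu phi ->
  forall B : set (borel (OFilt K)), measurable B -> nu B = mu B.
Proof.
move=> Rmu Rnu rmu rnu B mB.
have [_ _ ->] := Rmu => //; have [_ _ ->] := Rnu => //.
congr ereal_inf; apply: eq_imagel => U [oU _].
by apply/eqP; rewrite eq_le !(@represents_le_open _ _ phi).
Qed.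

Lemma represents_nabla_nonneg mu phi : represents mu phi -> nabla_nonneg phi.
Proof.
move=> rep s x; rewrite -lee_fin -(represents_basic_set (x, s) rep).
exact: measure_ge0.
Qed.

(** The open sets [containing z] with [z] way below [x] cover [containing x]. A compact subset needs
    finitely many of them, hence by directedness only one; inner regularity then gives the
    supremum. *)
Lemma represents_way_below_sup mu phi x : is_radon mu -> represents mu phi ->
  supremums [set phi z | z in [set z | way_below z x]] (phi x).
Proof.
move=> [_ inmu _] rep.
have phi_le y z := @nabla_nonneg_le _ _ _ phi y z (represents_nabla_nonneg rep).
split=> [_ [z zx <-]|r rP]; first exact/phi_le/way_below_le.
rewrite -lee_fin rep inmu; last exact: open_containing.
apply: ge_ereal_sup => _ [C [cC Cx] <-].
move: (cC); rewrite compact_cover.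
move=> /(_ K [set z | way_below z x] (fun z => containing z)).
case=> [z _|V /Cx /(ofilt_below K_domain)[z zx Vz]|D Dx CD].
- exact: open_containing.
- by exists z.
have [z zx zD] : exists2 z, way_below z x &
    forall y, y \in enum_fset D -> (y <= z)%O.
  have : forall y, y \in enum_fset D -> way_below y x by move=> y /Dx /set_mem.
  elim: (enum_fset D) => [_|y t IH tx].
    by have [[z zx] _] := way_below_directed K_domain x; exists z.
  have [|w wx wt] := IH.
    by move=> v vt; apply: tx; rewrite in_cons vt orbT.
  have yx := tx y (mem_head _ _).
  have [_ /(_ y w yx wx)[z [zx yz wz]]] := way_below_directed K_domain x.
  exists z => // v; rewrite in_cons => /orP[/eqP -> //|/wt vw].
  exact: le_trans wz.
apply: (@le_trans _ _ (phi z)%:E); last by rewrite lee_fin; apply: rP; exists z.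
rewrite rep; apply: le_measure; rewrite ?inE.
- exact: measurable_compact.
- exact: measurable_containing.
by move=> V /CD[y /= yD]; apply: le_containing; exact: zD.
Qed.

Lemma nabla_nonneg_represented phi : nabla_nonneg phi ->
  (forall x, supremums [set phi z | z in [set z | way_below z x]] (phi x)) ->
  exists2 mu, is_radon mu & represents mu phi.
Proof.
move=> phi0 phi_sup.
have [m fm mE] := finitely_additive_extension K_domain K_top K_mult phi0.
have [mu [Rmu muE]] := radon_regularization
  (hausdorff_OFilt K_domain K_top K_mult)
  (compact_OFilt K_domain K_top K_mult) fm.
exists mu => // x; rewrite muE; last exact: open_containing.
apply/eqP; rewrite eq_le; apply/andP; split; last first.
  by rewrite -mE; exact: inner_content_le_content.
rewrite -[leRHS]fineK ?inner_content_fin_num // lee_fin.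
have [_] := phi_sup x; apply => _ [z zx <-].
rewrite -lee_fin fineK ?inner_content_fin_num //.
(* The filters above [W] form a closed set between [containing z] and [containing x], so its
   [m]-value is at least [phi z] and counts in the inner content. *)
pose W := way_above K_domain K_top K_mult z.
apply: (@le_trans _ _ (m [set V | (W <= V)%O])%:E).
  rewrite lee_fin -mE finitely_additive_le //.
  exact: containing_sub_way_above.
apply: closed_inner_content; first exact: closed_above.
exact: way_above_sub_containing.
Qed.

End Representation.

Theorem theorem5p3 (d : Order.disp_t) (K : tLatticeType d) (R : realType)
    (K_domain : is_domain K)
    (K_top : way_below (\top%O : K) \top%O)
    (K_mult : multiplicative_way_below K)
    (phi : K -> R) (phi_ge0 : forall x, 0 <= phi x) (phi1 : phi \top%O = 1) :
  (exists mu : {measure set (borel (OFilt K)) -> \bar R},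
     [/\ is_radon mu, represents mu phi
       & forall nu : {measure set (borel (OFilt K)) -> \bar R},
           is_radon nu -> represents nu phi ->
           forall B : set (borel (OFilt K)), measurable B -> nu B = mu B])
  <-> completely_monotone phi /\ scott_function phi.
Proof.
split=> [[mu [Rmu rep _]]|[[_ cm] [_ phi_sup _]]].
  have phi0 := represents_nabla_nonneg rep.
  split; first by split=> [x y|s _]; [exact: nabla_nonneg_le|exact: phi0].
  by split=> // x; apply: represents_way_below_sup Rmu rep.
(* Complete monotonicity speaks of nonempty lists only; the empty one is [phi_ge0]. *)
have phi0 : nabla_nonneg phi by case=> [|z s] x; [exact: phi_ge0|exact: cm].
have [mu Rmu rep] :=
  nabla_nonneg_represented K_domain K_top K_mult phi0 phi_sup.
exists mu; split => // nu Rnu rnu.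
exact: represents_unique Rmu Rnu rep rnu.
Qed.
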